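(* For each candidate edge $e\in\mathcal E_{\mathrm c}$ and $\mathbf w\in\mathbb R^p_{\ge0}$ define the cost-normalized marginal benefit $$\Theta_e(\mathbf w):=\frac{n}{c_e}\bigl\|\mathbf M(\mathbf w)^{-1}\mathbf a_e\bigr\|_2^2 .$$ Then $$\Theta_e(\mathbf w)=-\frac1{c_e}\frac{\partial R_{\mathrm{tot}}(\mathbf w)}{\partial w_e},$$ and $\Theta_e(\mathbf w)>0$ for every $\mathbf w\in\mathbb R^p_{\ge0}$ and every $e\in\mathcal E_{\mathrm c}$. Moreover, let $(\mathbf w^\star,\mathbf z^\star)$ be a KKT point of the reduced relaxed problem, let $\mu$ be the associated multiplier of the budget constraint $\mathbf c^\top\mathbf w\le C$, and define $$S_{\mathrm{int}}^\star:=\{e\in\mathcal E_{\mathrm c}: z_e^\star w_{\min}<w_e^\star<z_e^\star w_{\max}\}.$$ Then for every $e\in S_{\mathrm{int}}^\star$, $\Theta_e(\mathbf w^\star)=\mu$. If $S_{\mathrm{int}}^\star\neq\emptyset$, then $\mu>0$ and the budget is active: $\mathbf c^\top\mathbf w^\star=C$.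
   Context: Let $\mathcal G$ be an undirected connected graph on $n$ nodes $v_1,\dots,v_n$ with base edge set $\mathcal E_{\mathrm b}$ (no self-loops) and fixed positive base edge weights; let $\mathbf L_{\mathrm b}$ be its weighted Laplacian (degree matrix minus weighted adjacency matrix). Let $\mathcal E_{\mathrm c}$ be a set of $p$ candidate edges, i.e. unordered pairs of distinct nodes, disjoint from $\mathcal E_{\mathrm b}$. For a candidate $e=\{v_i,v_j\}$ fix an arbitrary orientation and let $\mathbf a_e\in\mathbb R^n$ have $i$-th entry $1$, $j$-th entry $-1$, and zeros elsewhere. Put $$\mathbf M(\mathbf w)=\mathbf L_{\mathrm b}+\sum_{e\in\mathcal E_{\mathrm c}}w_e\mathbf a_e\mathbf a_e^\top+\tfrac1n\mathbf 1\mathbf 1^\top,\qquad R_{\mathrm{tot}}(\mathbf w)=n\operatorname{Tr}\bigl(\mathbf M(\mathbf w)^{-1}\bigr)-n .$$ Since the base graph is connected, $\mathbf M(\mathbf w)\succ0$ for all $\mathbf w\in\mathbb R^p_{\ge0}$ (and hence on a neighbourhood of each such $\mathbf w$, so the partial derivatives of $R_{\mathrm{tot}}$ make sense there). Data: per-unit costs $c_e>0$, budget $C>0$, target cardinality $k\in\{1,\dots,p\}$, weight bounds $0<w_{\min}\le w_{\max}$. Reduced relaxed problem (the semidefinite relaxation after eliminating its auxiliary matrix variable): minimize $R_{\mathrm{tot}}(\mathbf w)$ over $(\mathbf w,\mathbf z)$ subject to $\mathbf c^\top\mathbf w\le C$; $z_ew_{\min}\le w_e\le z_ew_{\max}$ and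 $0\le z_e\le1$ for all $e\in\mathcal E_{\mathrm c}$; $\mathbf 1^\top\mathbf z=k$. A KKT point of this problem is a feasible $(\mathbf w^\star,\mathbf z^\star)$ for which there exist multipliers $\mu\ge0$ (budget), $\alpha_e\ge0$ (for $z_ew_{\min}-w_e\le0$), $\gamma_e\ge0$ (for $w_e-z_ew_{\max}\le0$), $\xi_e\ge0$ (for $-z_e\le0$), $\eta_e\ge0$ (for $z_e-1\le0$) and $\nu\in\mathbb R$ (for $\mathbf 1^\top\mathbf z=k$) satisfying, for all $e$, stationarity $\frac{\partial R_{\mathrm{tot}}(\mathbf w^\star)}{\partial w_e}+\mu c_e-\alpha_e+\gamma_e=0$ and $\alpha_ew_{\min}-\gamma_ew_{\max}-\xi_e+\eta_e+\nu=0$, together with complementary slackness for every inequality constraint: $\mu(\mathbf c^\top\mathbf w^\star-C)=0$, $\alpha_e(z_e^\star w_{\min}-w_e^\star)=0$, $\gamma_e(w_e^\star-z_e^\star w_{\max})=0$, $\xi_ez_e^\star=0$, $\eta_e(z_e^\star-1)=0$. *)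

(* Defs.v *)
From HB Require Import structures.
From mathcomp Require Import all_boot all_order all_algebra.
From mathcomp Require Import reals topology normedtype derive.

Set Implicit Arguments.
Unset Strict Implicit.
Unset Printing Implicit Defensive.

Import Order.TTheory GRing.Theory Num.Theory.
Import numFieldNormedType.Exports.

Local Open Scope ring_scope.

Record connected_weighted_graph (R : realType) (n : nat)
    (Eb : rel 'I_n) (wb : 'I_n -> 'I_n -> R) : Prop := {
  base_sym : symmetric Eb;
  base_irrefl : irreflexive Eb;
  base_connected : forall i j, connect Eb i j;
  base_weight_sym : forall i j, Eb i j -> wb i j = wb j i;
  base_weight_pos : forall i j, Eb i j -> 0 < wb i j }.

(* The [p] candidate edges are enumerated by ['I_p]; the [e]-th one is the     *)
(* unordered pair [[set src e; dst e]], oriented from [src e] to [dst e].      *)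
Record candidate_edges (n p : nat) (Eb : rel 'I_n) (src dst : 'I_p -> 'I_n) :
    Prop := {
  cand_distinct_ends : forall e, src e != dst e;
  cand_not_base : forall e, ~~ Eb (src e) (dst e);
  cand_inj : injective (fun e => [set src e; dst e]%SET) }.

Definition weighted_adjacency (R : realType) (n : nat)
    (Eb : rel 'I_n) (wb : 'I_n -> 'I_n -> R) : 'M[R]_n :=
  \matrix_(i, j) (if Eb i j then wb i j else 0).

Definition weighted_degree (R : realType) (n : nat)
    (Eb : rel 'I_n) (wb : 'I_n -> 'I_n -> R) : 'M[R]_n :=
  diag_mx (\row_i \sum_(j | Eb i j) wb i j).

Definition laplacian (R : realType) (n : nat)
    (Eb : rel 'I_n) (wb : 'I_n -> 'I_n -> R) : 'M[R]_n :=
  weighted_degree Eb wb - weighted_adjacency Eb wb.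

Definition incidence_vec (R : realType) (n p : nat) (src dst : 'I_p -> 'I_n)
    (e : 'I_p) : 'cV[R]_n :=
  delta_mx (src e) 0 - delta_mx (dst e) 0.

Definition ones (R : realType) (m : nat) : 'cV[R]_m := const_mx 1.

Definition Mmx (R : realType) (n p : nat) (Eb : rel 'I_n)
    (wb : 'I_n -> 'I_n -> R) (src dst : 'I_p -> 'I_n) (w : 'cV[R]_p) : 'M[R]_n :=
  laplacian Eb wb
  + \sum_(e < p)
      w e 0 *: (incidence_vec R src dst e *m (incidence_vec R src dst e)^T)
  + n%:R^-1 *: (ones R n *m (ones R n)^T).

Definition Rtot (R : realType) (n p : nat) (Eb : rel 'I_n)
    (wb : 'I_n -> 'I_n -> R) (src dst : 'I_p -> 'I_n) (w : 'cV[R]_p) : R :=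
  n%:R * \tr (invmx (Mmx Eb wb src dst w)) - n%:R.

(* The library norm on matrices is the sup norm, hence this definition.        *)
Definition norm2 (R : realType) (m : nat) (x : 'cV[R]_m) : R :=
  Num.sqrt (\sum_i x i 0 ^+ 2).

Definition dotv (R : realType) (m : nat) (x y : 'cV[R]_m) : R :=
  (x^T *m y) 0 0.

Definition nonneg_vec (R : realType) (m : nat) (x : 'cV[R]_m) : Prop :=
  forall i, 0 <= x i 0.

Definition partial (R : realType) (m : nat) (f : 'cV[R]_m -> R) (i : 'I_m)
    (x : 'cV[R]_m) : R :=
  derive f x (delta_mx i 0 : 'cV[R]_m).

Definition partially_derivable (R : realType) (m : nat) (f : 'cV[R]_m -> R)
    (i : 'I_m) (x : 'cV[R]_m) : Prop :=
  derivable f x (delta_mx i 0 : 'cV[R]_m).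

Definition Theta (R : realType) (n p : nat) (Eb : rel 'I_n)
    (wb : 'I_n -> 'I_n -> R) (src dst : 'I_p -> 'I_n) (c : 'cV[R]_p)
    (e : 'I_p) (w : 'cV[R]_p) : R :=
  n%:R / c e 0
  * norm2 (invmx (Mmx Eb wb src dst w) *m incidence_vec R src dst e) ^+ 2.

Record feasible (R : realType) (p : nat) (c : 'cV[R]_p) (C : R) (k : nat)
    (wmin wmax : R) (w z : 'cV[R]_p) : Prop := {
  feas_budget : dotv c w <= C;
  feas_lower : forall e, z e 0 * wmin <= w e 0;
  feas_upper : forall e, w e 0 <= z e 0 * wmax;
  feas_z_ge0 : forall e, 0 <= z e 0;
  feas_z_le1 : forall e, z e 0 <= 1;
  feas_card : dotv (ones R p) z = k%:R }.

(* [(w, z)] is a KKT point of "minimize [f w] over the feasible [(w, z)]", and *)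
(* [mu], [alpha], [gamma], [xi], [eta], [nu] are associated multipliers.       *)
Record KKT (R : realType) (p : nat) (f : 'cV[R]_p -> R) (c : 'cV[R]_p) (C : R)
    (k : nat) (wmin wmax : R) (w z : 'cV[R]_p)
    (mu : R) (alpha gamma xi eta : 'cV[R]_p) (nu : R) : Prop := {
  kkt_feasible : feasible c C k wmin wmax w z;
  kkt_mu_ge0 : 0 <= mu;
  kkt_alpha_ge0 : nonneg_vec alpha;
  kkt_gamma_ge0 : nonneg_vec gamma;
  kkt_xi_ge0 : nonneg_vec xi;
  kkt_eta_ge0 : nonneg_vec eta;
  kkt_stat_w : forall e,
    partial f e w + mu * c e 0 - alpha e 0 + gamma e 0 = 0;
  kkt_stat_z : forall e,
    alpha e 0 * wmin - gamma e 0 * wmax - xi e 0 + eta e 0 + nu = 0;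
  kkt_slack_budget : mu * (dotv c w - C) = 0;
  kkt_slack_lower : forall e, alpha e 0 * (z e 0 * wmin - w e 0) = 0;
  kkt_slack_upper : forall e, gamma e 0 * (w e 0 - z e 0 * wmax) = 0;
  kkt_slack_z_ge0 : forall e, xi e 0 * z e 0 = 0;
  kkt_slack_z_le1 : forall e, eta e 0 * (z e 0 - 1) = 0 }.

Definition Sint (R : realType) (p : nat) (wmin wmax : R) (w z : 'cV[R]_p) :
    {set 'I_p} :=
  [set e | z e 0 * wmin < w e 0 < z e 0 * wmax]%SET.

(* Main.v *)
(** Along the direction of a candidate edge [e] the matrix [M] changes by the
    rank-one term [h a a^T], so the Sherman-Morrison formula gives
    [tr M(w + h e)^-1 = tr M(w)^-1 - h / (1 + h s) * |M(w)^-1 a|^2] with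
    [s = a^T M(w)^-1 a]; dividing by [h] and letting [h] tend to [0] yields the
    partial derivative.  [M(w)] is invertible since [x^T M(w) x] is a sum of
    squares, whose vanishing forces [x] to be constant along base edges, hence
    constant by connectedness, and to have zero sum.  At an interior edge both
    bounds on [w e] are slack, so stationarity reads [Theta e w = mu]. *)
Require Import Defs.
From mathcomp Require Import all_boot all_order all_algebra.
From mathcomp Require Import reals topology normedtype derive.
From mathcomp Require Import ring.

Import Order.TTheory GRing.Theory Num.Theory.
Import numFieldNormedType.Exports.

Local Open Scope ring_scope.

(** * Rank-one updates and the Euclidean norm *)

(** The right-hand side is checked to be a right inverse of [A + u *m v]; for square matrices this
    also gives invertibility, hence equality with [invmx]. *)
Lemma sherman_morrison (F : fieldType) (n : nat) (A : 'M[F]_n)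
    (u : 'cV[F]_n) (v : 'rV[F]_n) :
  A \in unitmx -> 1 + (v *m invmx A *m u) 0 0 != 0 ->
  invmx (A + u *m v) = invmx A
    - (1 + (v *m invmx A *m u) 0 0)^-1 *: (invmx A *m u *m (v *m invmx A)).
Proof.
set s := (v *m invmx A *m u) 0 0 => Au s1.
have vAu : v *m (invmx A *m u) = s%:M by rewrite mulmxA -mx11_scalar.
set B := (X in _ = X).
have XB : (A + u *m v) *m B = 1%:M.
  rewrite /B mulmxBr !mulmxDl mulmxV // -!scalemxAr.
  rewrite (mulmxA A) (mulmxA A) mulmxV // mul1mx.
  (* Reassociation isolates the 1 x 1 product [s]. The correction terms then add up to [1 + s] times
     [u *m (v *m invmx A)], and this factor cancels. *)
  rewrite -(mulmxA u v (invmx A *m u *m _)) (mulmxA v (invmx A *m u)) vAu.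
  rewrite mul_scalar_mx -scalemxAr -(mulmxA u v (invmx A)).
  rewrite -scalerDr -[X in X + s *: _]scale1r -scalerDl scalerA mulVf // scale1r.
  by rewrite addrK.
have [Xu _] := mulmx1_unit XB.
by rewrite -[LHS]mulmx1 -XB mulKmx.
Qed.

Lemma mxtrace_mul_tr (R : realType) (n : nat) (x : 'cV[R]_n) :
  \tr (x *m x^T) = norm2 x ^+ 2.
Proof.
rewrite /norm2 sqr_sqrtr; last by apply: sumr_ge0 => i _; exact: sqr_ge0.
by apply: eq_bigr => i _; rewrite !mxE big_ord1 !mxE expr2.
Qed.

Lemma norm2_gt0 (R : realType) (n : nat) (x : 'cV[R]_n) :
  x != 0 -> 0 < norm2 x.
Proof.
move=> x0; have ge0 : 0 <= \sum_i x i 0 ^+ 2.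
  by apply: sumr_ge0 => i _; exact: sqr_ge0.
rewrite /norm2 sqrtr_gt0 lt0r ge0 andbT; apply: contraNneq x0 => s0.
apply/eqP/matrixP => i j; rewrite (ord1 j) mxE; apply/eqP.
rewrite -sqrf_eq0; apply/eqP.
by apply: (psumr_eq0P _ s0) => // ? _; exact: sqr_ge0.
Qed.

Lemma dotv_rank1 (R : realType) (n : nat) (x a : 'cV[R]_n) :
  dotv x ((a *m a^T) *m x) = dotv a x ^+ 2.
Proof.
rewrite /dotv -mulmxA mulmxA mxE big_ord1 expr2; congr (_ * _).
by rewrite -[a in LHS]trmxK -trmx_mul mxE.
Qed.

(** * Positivity of the quadratic form and invertibility of [M w] *)

Section Graph.
Local Open Scope classical_set_scope.
Local Open Scope ring_scope.
Variables (R : realType) (n p : nat) (Eb : rel 'I_n) (wb : 'I_n -> 'I_n -> R).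
Variables (src dst : 'I_p -> 'I_n).
Hypothesis graph : connected_weighted_graph Eb wb.

Let adj := weighted_adjacency Eb wb.
Let a := incidence_vec R src dst.
Let M := Mmx Eb wb src dst.

Lemma adjacency_sym i j : adj i j = adj j i.
Proof.
rewrite !mxE (base_sym graph j i); case: ifP => // Eij.
exact: base_weight_sym graph _ _ Eij.
Qed.

Lemma adjacency_ge0 i j : 0 <= adj i j.
Proof. by rewrite mxE; case: ifP => // /(base_weight_pos graph)/ltW. Qed.

Lemma laplacian_mulE (x : 'cV[R]_n) i :
  (laplacian Eb wb *m x) i 0 = \sum_j adj i j * (x i 0 - x j 0).
Proof.
rewrite mulmxBl mul_diag_mx !mxE big_mkcond mulr_suml -sumrB.
by apply: eq_bigr => j _; rewrite !mxE mulrBr.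
Qed.

Lemma laplacian_quad (x : 'cV[R]_n) :
  dotv x (laplacian Eb wb *m x) *+ 2
    = \sum_i \sum_j adj i j * (x i 0 - x j 0) ^+ 2.
Proof.
have dE : dotv x (laplacian Eb wb *m x)
    = \sum_i \sum_j adj i j * (x i 0 - x j 0) * x i 0.
  rewrite /dotv mxE; apply: eq_bigr => i _.
  by rewrite laplacian_mulE mxE mulrC mulr_suml.
(* Swapping [i] and [j] in one of the two copies pairs [(x i - x j) * x i] with [(x j - x i) * x j],
   and these add up to a square. *)
rewrite mulr2n {1}dE exchange_big dE -big_split; apply: eq_bigr => i _ /=.
rewrite -big_split; apply: eq_bigr => j _ /=.
by rewrite (adjacency_sym j i); ring.
Qed.

Lemma laplacian_tr : (laplacian Eb wb)^T = laplacian Eb wb.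
Proof.
rewrite linearB /= tr_diag_mx; congr (_ - _).
by apply/matrixP => i j; rewrite mxE -/adj adjacency_sym.
Qed.

Lemma Mmx_tr w : (M w)^T = M w.
Proof.
rewrite /M /Mmx 2!linearD /= laplacian_tr linearZ /= trmx_mul trmxK.
congr (_ + _ + _); rewrite linear_sum; apply: eq_bigr => e _ /=.
by rewrite linearZ /= trmx_mul trmxK.
Qed.

Lemma Mmx_quad w (x : 'cV[R]_n) :
  dotv x (M w *m x) = dotv x (laplacian Eb wb *m x)
    + \sum_e w e 0 * dotv (a e) x ^+ 2 + n%:R^-1 * dotv (ones R n) x ^+ 2.
Proof.
have dD y z : dotv x (y + z) = dotv x y + dotv x z.
  by rewrite /dotv mulmxDr mxE.
have dZ t y : dotv x (t *: y) = t * dotv x y.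
  by rewrite /dotv -scalemxAr mxE.
rewrite /M /Mmx !mulmxDl !dD -scalemxAl dZ dotv_rank1; congr (_ + _ + _).
rewrite mulmx_suml /dotv mulmx_sumr summxE; apply: eq_bigr => e _.
  by rewrite -[LHS]/(dotv x _) -scalemxAl dZ dotv_rank1.
Qed.

Lemma laplacian_quad_ge0 (x : 'cV[R]_n) : 0 <= dotv x (laplacian Eb wb *m x).
Proof.
rewrite -(pmulrn_lge0 _ (ltn0Sn 1)) laplacian_quad.
apply: sumr_ge0 => i _; apply: sumr_ge0 => j _.
by rewrite mulr_ge0 ?adjacency_ge0 ?sqr_ge0.
Qed.

Lemma laplacian_quad_eq0 (x : 'cV[R]_n) :
  dotv x (laplacian Eb wb *m x) = 0 -> forall i j, x i 0 = x j 0.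
Proof.
move=> q0; have t_ge0 i j : 0 <= adj i j * (x i 0 - x j 0) ^+ 2.
  by rewrite mulr_ge0 ?adjacency_ge0 ?sqr_ge0.
have s0 : \sum_i \sum_j adj i j * (x i 0 - x j 0) ^+ 2 = 0.
  by rewrite -laplacian_quad q0 mul0rn.
have edge i j : Eb i j -> x i 0 = x j 0.
  move=> Eij; have := psumr_eq0P (fun i _ => sumr_ge0 _ (fun j _ => t_ge0 i j)) s0.
  move=> /(_ i isT)/(psumr_eq0P (fun j _ => t_ge0 i j))/(_ j isT)/eqP.
  rewrite mxE Eij mulf_eq0 sqrf_eq0 subr_eq0.
  by rewrite gt_eqF ?(base_weight_pos graph) // => /eqP.
(* Equality across base edges propagates along a path from [i] to [j]. *)
move=> i j; have /connectP[s] := base_connected graph i j.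
elim: s i => [|k s IHs] i /=; first by move=> _ ->.
by case/andP=> /edge -> /IHs.
Qed.

Lemma Mmx_unit w : nonneg_vec w -> M w \in unitmx.
Proof.
(* It suffices that the left kernel is trivial: a kernel vector annihilates the form, so each of its
   three nonnegative parts vanishes. *)
move=> w0; rewrite -row_free_unit; apply: inj_row_free => v vM0.
set x := v^T.
have q0 : dotv x (M w *m x) = 0.
  by rewrite /dotv mulmxA trmxK vM0 mul0mx mxE.
move: q0; rewrite Mmx_quad.
set q1 := dotv x _; set q2 := \sum_e _; set q3 := n%:R^-1 * _.
have q1_ge0 : 0 <= q1 := laplacian_quad_ge0 x.
have q2_ge0 : 0 <= q2 by apply: sumr_ge0 => e _; rewrite mulr_ge0 ?sqr_ge0 ?w0.
have q3_ge0 : 0 <= q3 by rewrite mulr_ge0 ?sqr_ge0 ?invr_ge0.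
move/eqP; rewrite !paddr_eq0 ?addr_ge0 // => /andP[/andP[/eqP q10 _] q30].
have xconst := laplacian_quad_eq0 x q10.
apply/matrixP => i j; rewrite (ord1 i) mxE.
have n0 : n%:R != 0 :> R by rewrite pnatr_eq0 -lt0n (leq_ltn_trans _ (ltn_ord j)).
move: q30; rewrite mulf_eq0 invr_eq0 (negbTE n0) sqrf_eq0 /= /dotv mxE.
rewrite (eq_bigr (fun=> v 0 j)) => [|k _]; last first.
  by rewrite (xconst k j) !mxE mul1r.
rewrite sumr_const card_ord -mulr_natr mulf_eq0 (negbTE n0) orbF.
by move/eqP.
Qed.

(** * Derivative along a candidate edge *)

(** The argument has the shape found in the difference quotient of [derive], and [h] sits in the
    column factor to match [sherman_morrison]. *)
Lemma Mmx_shift w (e : 'I_p) (h : R) :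
  M (h *: delta_mx e 0 + w) = M w + (h *: a e) *m (a e)^T.
Proof.
rewrite /M /Mmx [RHS]addrAC -[X in _ = X + _]addrA; congr (_ + _ + _).
under eq_bigr => f _ do rewrite mxE scalerDl.
rewrite big_split /= addrC; congr (_ + _).
rewrite (bigD1 e) //= big1 => [|f fe]; last by rewrite !mxE (negbTE fe) mulr0 scale0r.
by rewrite !mxE !eqxx mulr1 addr0 -scalemxAl.
Qed.

(** For negative [h] the shifted weights may leave the nonnegative orthant; the nonzero denominator
    secures invertibility there. By symmetry of [M w] the correction is a multiple of [x *m x^T]
    with [x = invmx (M w) *m a e], whose trace is a squared norm. *)
Lemma Rtot_shift w (e : 'I_p) (h : R) : nonneg_vec w ->
  let s := dotv (a e) (invmx (M w) *m a e) in
  1 + h * s != 0 ->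
  Rtot Eb wb src dst (h *: delta_mx e 0 + w) = Rtot Eb wb src dst w
    - h * (n%:R * norm2 (invmx (M w) *m a e) ^+ 2 / (1 + h * s)).
Proof.
move=> w0 s s0; rewrite /Rtot -/(M _) Mmx_shift.
have sE : ((a e)^T *m invmx (M w) *m (h *: a e)) 0 0 = h * s.
  by rewrite -scalemxAr -mulmxA mxE.
have aMi : (a e)^T *m invmx (M w) = (invmx (M w) *m a e)^T.
  by rewrite trmx_mul trmx_inv Mmx_tr.
rewrite sherman_morrison ?Mmx_unit ?sE // linearB /= linearZ /= aMi.
rewrite -scalemxAr -scalemxAl mxtraceZ mxtrace_mul_tr -/(M w).
by move: (_ ^-1) => t; ring.
Qed.

Lemma Rtot_quotient_cvg w (e : 'I_p) : nonneg_vec w ->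
  h^-1 *: (Rtot Eb wb src dst (h *: delta_mx e 0 + w) - Rtot Eb wb src dst w)
    @[h --> 0^'] --> - (n%:R * norm2 (invmx (M w) *m a e) ^+ 2).
Proof.
move=> w0; set s := dotv (a e) (invmx (M w) *m a e); set q := n%:R * _.
have d_cvg : (1 + h * s) @[h --> 0^'] --> (1 : R).
  rewrite -[X in _ --> X]addr0 -[X in _ --> _ + X](mul0r s).
  apply: cvgD; first exact: cvg_cst.
  apply: cvgM; last exact: cvg_cst.
  by apply: cvg_within_filter; exact: cvg_id.
have d_neq0 : \forall h \near 0^', 1 + h * s != 0.
  by apply: (cvgr_neq0 _ d_cvg); exact: oner_neq0.
(* Near [0], away from [0] itself, the quotient equals this closed form, whose denominator tends to
   [1]. *)
apply: (@cvg_trans _ ((- (q / (1 + h * s))) @[h --> 0^'])); last first.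
  apply: cvgN; rewrite -[X in _ --> X](_ : q * 1^-1 = q); last first.
    by rewrite invr1 mulr1.
  by apply: cvgM; [exact: cvg_cst | apply: cvgV] => //; exact: oner_neq0.
apply: near_eq_cvg; near=> h.
have h0 : h != 0 by near: h; exact: nbhs_dnbhs_neq.
rewrite Rtot_shift //; last by near: h.
by rewrite -/s -/q addrAC subrr add0r scalerN /GRing.scale /= mulKf.
Unshelve. all: by end_near.
Qed.

Lemma partially_derivable_Rtot w (e : 'I_p) : nonneg_vec w ->
  partially_derivable (Rtot Eb wb src dst) e w.
Proof. by move=> w0; apply/cvg_ex; eexists; exact: Rtot_quotient_cvg. Qed.

Lemma partial_Rtot w (e : 'I_p) : nonneg_vec w ->
  partial (Rtot Eb wb src dst) e w
    = - (n%:R * norm2 (invmx (M w) *m a e) ^+ 2).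
Proof. by move=> w0; apply: cvg_lim => //; exact: Rtot_quotient_cvg. Qed.

Lemma Theta_partial (c : 'cV[R]_p) w (e : 'I_p) : nonneg_vec w ->
  Theta Eb wb src dst c e w
    = - (1 / c e 0) * partial (Rtot Eb wb src dst) e w.
Proof. by move=> w0; rewrite partial_Rtot // /Theta -/(M w) -/(a e); ring. Qed.

Lemma Theta_gt0 (c : 'cV[R]_p) w (e : 'I_p) :
  src e != dst e -> 0 < c e 0 -> nonneg_vec w ->
  0 < Theta Eb wb src dst c e w.
Proof.
move=> sd c0 w0; rewrite mulr_gt0 ?divr_gt0 //.
  by rewrite ltr0n (leq_ltn_trans _ (ltn_ord (src e))).
(* If [invmx (M w) *m a e] were zero, so would be [a e], yet its entry at [src e] is [1]. *)
rewrite exprn_gt0 // norm2_gt0 //; apply/eqP => Ma0.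
have /matrixP/(_ (src e) 0) : a e = 0.
  by rewrite -[a e](mulKVmx (Mmx_unit w w0)) Ma0 mulmx0.
by rewrite !mxE !eqxx (negbTE sd) subr0 => /eqP; rewrite oner_eq0.
Qed.

End Graph.

(** * Consequences of the KKT conditions *)

Lemma feasible_nonneg (R : realType) (p : nat) (c : 'cV[R]_p) (C : R) (k : nat)
    (wmin wmax : R) (w z : 'cV[R]_p) :
  0 <= wmin -> feasible c C k wmin wmax w z -> nonneg_vec w.
Proof.
move=> wmin0 fz e; apply: le_trans (feas_lower fz e).
by rewrite mulr_ge0 ?(feas_z_ge0 fz).
Qed.
Arguments feasible_nonneg {R p c C k wmin wmax w z}.

Lemma KKT_partial_Sint (R : realType) (p : nat) (f : 'cV[R]_p -> R)
    (c : 'cV[R]_p) (C : R) (k : nat) (wmin wmax : R) (w z : 'cV[R]_p)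
    (mu : R) (alpha gamma xi eta : 'cV[R]_p) (nu : R) (e : 'I_p) :
  KKT f c C k wmin wmax w z mu alpha gamma xi eta nu ->
  e \in Sint wmin wmax w z -> partial f e w = - (mu * c e 0).
Proof.
move=> kkt; rewrite inE => /andP[lo hi].
have := kkt_slack_lower kkt e; move/eqP.
rewrite mulf_eq0 subr_eq0 (lt_eqF lo) orbF => /eqP alpha0.
have := kkt_slack_upper kkt e; move/eqP.
rewrite mulf_eq0 subr_eq0 (lt_eqF hi) orbF => /eqP gamma0.
have := kkt_stat_w kkt e; rewrite alpha0 gamma0 subr0 addr0.
by move/eqP; rewrite addr_eq0 => /eqP.
Qed.
Arguments KKT_partial_Sint {R p f c C k wmin wmax w z mu alpha gamma xi eta nu e}.

Theorem proposition2 (R : realType) (n p : nat)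
    (Eb : rel 'I_n) (wb : 'I_n -> 'I_n -> R)
    (src dst : 'I_p -> 'I_n)
    (c : 'cV[R]_p) (C : R) (k : nat) (wmin wmax : R)
    (base_graph : connected_weighted_graph Eb wb)
    (candidates : candidate_edges Eb src dst)
    (c_pos : forall e, 0 < c e 0)
    (C_pos : 0 < C)
    (k_range : (1 <= k <= p)%N)
    (wmin_pos : 0 < wmin)
    (wmin_le_wmax : wmin <= wmax) :
  (forall (e : 'I_p) (w : 'cV[R]_p), nonneg_vec w ->
     [/\ partially_derivable (Rtot Eb wb src dst) e w,
         Theta Eb wb src dst c e w
           = - (1 / c e 0) * partial (Rtot Eb wb src dst) e w
       & 0 < Theta Eb wb src dst c e w])
  /\
  (forall (w z : 'cV[R]_p)
          (mu : R) (alpha gamma xi eta : 'cV[R]_p) (nu : R),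
     KKT (Rtot Eb wb src dst) c C k wmin wmax w z mu alpha gamma xi eta nu ->
     (forall e, e \in Sint wmin wmax w z -> Theta Eb wb src dst c e w = mu)
     /\
     (Sint wmin wmax w z != set0 -> 0 < mu /\ dotv c w = C)).
Proof.
have sd := cand_distinct_ends candidates.
split=> [e w w0|w z mu alpha gamma xi eta nu kkt].
  split; [exact: partially_derivable_Rtot | exact: Theta_partial |].
  exact: Theta_gt0.
have w0 := feasible_nonneg (ltW wmin_pos) (kkt_feasible kkt).
have ThetaE e : e \in Sint wmin wmax w z -> Theta Eb wb src dst c e w = mu.
  move=> eS; rewrite Theta_partial // (KKT_partial_Sint kkt eS).
  by rewrite mulrNN mulrCA div1r mulVf ?mulr1 // gt_eqF.
split=> // /set0Pn[e eS].
(* One interior edge identifies [mu] with a positive [Theta]; complementary slackness then makes the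
   budget tight. *)
have mu0 : 0 < mu by rewrite -(ThetaE e eS) Theta_gt0.
split=> //; have /eqP := kkt_slack_budget kkt.
by rewrite mulf_eq0 gt_eqF //= subr_eq0 => /eqP.
Qed.
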